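(* Let $f,g\colon[0,1]\to\mathbb{R}$ be functions with $f(0)=g(0)$, $f(1)=g(1)$ and $f(t)>g(t)$ for all $0<t<1$. If $f$ and $g$ are Lipschitz continuous of Lipschitz constant $1$, then for every $\theta\in(0,\pi/2]$ the Jordan curve $\gamma(f,g)\subset\mathbb{R}^2$, the union of the graphs of $f$ and $g$, inscribes a $\theta$-rectangle.
   Context: A Jordan curve inscribes a quadrilateral $Q$ if the curve contains four points forming the vertex set of such a $Q$. A $\theta$-rectangle is a (non-degenerate) rectangle whose diagonals meet at angle $\theta$. *)

(* Defs.v *)
From mathcomp Require Import all_boot all_order all_algebra.
From mathcomp Require Import all_classical all_reals all_analysis.
Set Implicit Arguments.
Unset Strict Implicit.
Unset Printing Implicit Defensive.
Import Order.TTheory GRing.Theory Num.Theory.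
Import numFieldNormedType.Exports.
Local Open Scope classical_set_scope.
Local Open Scope ring_scope.

(** The plane is the product [R * R].  The library norm on this product is the
    sup norm, so the Euclidean structure is given explicitly. *)
Definition dot (R : realType) (u v : R * R) : R := u.1 * v.1 + u.2 * v.2.

Definition enorm (R : realType) (u : R * R) : R := Num.sqrt (dot u u).

(** The unoriented angle, in [0, pi/2], between two lines with nonzero
    direction vectors [u] and [v]. *)
Definition line_angle (R : realType) (u v : R * R) : R :=
  acos (`|dot u v| / (enorm u * enorm v)).

(** [A], [B], [C], [D] are the vertices in cyclic order, so that the diagonals
    are [AC] and [BD].  The inequalities exclude degenerate rectangles; with the
    other two clauses they make the four vertices pairwise distinct. *)
Definition is_rectangle (R : realType) (A B C D : R * R) : Prop :=
  [/\ A != B, A != D, B - A = C - D & dot (B - A) (D - A) = 0].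

Definition theta_rectangle (R : realType) (theta : R) (A B C D : R * R) : Prop :=
  is_rectangle A B C D /\ line_angle (C - A) (D - B) = theta.

Definition inscribes (R : realType) (gamma : set (R * R))
    (Q : R * R -> R * R -> R * R -> R * R -> Prop) : Prop :=
  exists A B C D : R * R,
    [/\ gamma A, gamma B, gamma C & gamma D] /\ Q A B C D.

Definition graph01 (R : realType) (f : R -> R) : set (R * R) :=
  [set (t, f t) | t in `[0, 1]].

Definition gamma_curve (R : realType) (f g : R -> R) : set (R * R) :=
  graph01 f `|` graph01 g.

(* Main.v *)
(** Extend [f] and [g] to 1-Lipschitz functions [F] and [G] on the line by constants
    outside [0, 1], and let [HF], [HG] be antiderivatives.  A parallelogram with centre
    abscissa [p] has vertices over [p + r + s], [p + r - s], [p - r - s], [p - r + s].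
    With [tau = tan (theta / 2)], the function
      HF (p+r+s) + HG (p-r-s) - HF (p+r-s) - HG (p-r+s) - (2 / tau) r^2 + 2 tau s^2
    of (p, r, s) is critical exactly when the points over these four abscissae, the first
    two on the graph of [F] and the last two on that of [G], form a rectangle of aspect
    ratio [tau].  Since [F] and [G] are 1-Lipschitz and [tau <= 1], the function is concave
    in [r], so a critical point is found as the minimum over (p, s) of the maximum over [r].
    This min-max value is negative because the [s]-derivative at [r = s = 0] is
    [2 (F p - G p) > 0], and the value is [0] at degenerate rectangles ([r = s = 0]), so the
    rectangle is nondegenerate.  The Lipschitz bounds finally force all four abscissae into
    [0, 1]. *)
Require Import Defs.
From mathcomp Require Import all_boot all_order all_algebra.
From mathcomp Require Import all_classical all_reals all_analysis.
From mathcomp Require Import ring lra.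
Import Order.TTheory GRing.Theory Num.Theory.
Import numFieldNormedType.Exports.
Local Open Scope classical_set_scope.
Local Open Scope ring_scope.

Set Implicit Arguments.
Unset Strict Implicit.
Unset Printing Implicit Defensive.

(** * Antiderivatives of 1-Lipschitz functions *)

Definition lip1 (R : realType) (F : R -> R) := forall x y, `|F x - F y| <= `|x - y|.

Lemma lip1_continuous (R : realType) (F : R -> R) : lip1 F -> continuous F.
Proof.
move=> lF x; apply/cvgrPdist_lt => e e0; near=> y.
apply: le_lt_trans (lF x y) _; near: y.
exact: (@cvgr_dist_lt _ _ _ (nbhs x) _ id x).
Unshelve. all: by end_near. Qed.

(** Since [F - F0] vanishes on the negative half-line, its integral from [-1] is locally zero there,
    and the fundamental theorem of calculus is needed only for [0 <= x]. The linear term [F0 * x]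
    restores the constant. *)
Lemma antiderivative_of_continuous (R : realType) (F : R -> R) (F0 : R) :
  continuous F -> (forall x, x <= 0 -> F x = F0) ->
  exists H : R -> R, forall x : R, is_derive x (1 : R) H (F x).
Proof.
move=> cF FE; pose h x := F x - F0.
have ch : continuous h by move=> x; apply: cvgB; [exact: cF|exact: cvg_cst].
pose I (x : R) : R := (\int[lebesgue_measure]_(t in `[- 1, x]) h t)%R.
have dI x : is_derive x (1 : R) I (h x).
  have [x0|x0] := ltP x 0.
    have -> : h x = 0 by rewrite /h FE ?subrr// ltW.
    apply: (@near_eq_is_derive _ _ _ (cst 0)).
    near=> y; rewrite /I.
    transitivity (\int[lebesgue_measure]_(t in `[(- 1)%R, y]) (0:R))%R; last first.
      apply: eq_Rintegral => t; rewrite inE/= in_itv/= => /andP[_ ty].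
      rewrite /h FE ?subrr// (le_trans ty)//.
      by apply: ltW; near: y; exact: lt_nbhsl.
    by rewrite /Rintegral integral0.
  have [||||] := @continuous_FTC1 R h (BLeft (-1)) x (x + 1).
  - by rewrite ltrDl.
  - apply: continuous_compact_integrable; first exact: segment_compact.
    by move=> ?; apply: continuous_subspaceT.
  - by rewrite lte_fin; lra.
  - exact: ch.
  by move=> d1 <-; rewrite derive1E; exact: DeriveDef.
exists (fun x => F0 * x + I x) => x.
have -> : F x = F0 * 1 + h x by rewrite /h; ring.
by apply: is_deriveD.
Unshelve. all: by end_near. Qed.


Lemma antiderivative_MVT (R : realType) (F H : R -> R) :
  (forall x, is_derive x (1 : R) H (F x)) ->
  forall x y, exists2 c, (x <= c <= y) || (y <= c <= x) &
    H y - H x = F c * (y - x).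
Proof.
move=> dH.
have le x y : x <= y -> exists2 c, x <= c <= y & H y - H x = F c * (y - x).
  move=> xy; have [|c] := @MVT_segment R H F x y xy (fun z _ => dH z).
    apply: continuous_subspaceT => z.
    by apply: differentiable_continuous; apply/derivable1_diffP; have [] := dH z.
  by rewrite in_itv/= => cI eq; exists c.
move=> x y; have [/le[c cI eq]|/ltW/le[c cI eq]] := leP x y.
  by exists c => //; rewrite cI.
by exists c; [rewrite cI orbT|lra].
Qed.

Lemma antiderivative_lip (R : realType) (F H : R -> R) (B : R) :
  (forall x, is_derive x (1 : R) H (F x)) -> (forall x, `|F x| <= B) ->
  forall x y, `|H x - H y| <= B * `|x - y|.
Proof.
move=> dH bF x y; have [c _ ->] := antiderivative_MVT dH y x.
by rewrite normrM ler_wpM2r.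
Qed.

(** The difference [Q] of the two sides has derivative [F t - F x - (t - x)], whose sign is opposite
    to that of [t - x] because [F] is 1-Lipschitz; the mean value theorem concludes. *)
Lemma antiderivative_le_quadratic (R : realType) (F H : R -> R) : lip1 F ->
  (forall x, is_derive x (1 : R) H (F x)) ->
  forall x h, H (x + h) <= H x + F x * h + h ^+ 2 / 2.
Proof.
move=> lF dH x h.
pose Q t := H t - F x * t - (t - x) ^+ 2 / 2.
pose q t := F t - F x - (t - x).
have dQ t : is_derive t (1 : R) Q (q t).
  have -> : Q = H - F x *: id - 2^-1 *: (id - cst x) ^+ 2.
    by apply/funext => u; rewrite /Q !fctE/= /GRing.scale/= [2^-1 * _]mulrC.
  have dHt := dH t.
  apply: is_derive_eq; rewrite /q /GRing.scale/=.
  by have -> : (id - cst x) t = t - x by []; lra.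
have [c cI] := antiderivative_MVT dQ x (x + h).
have lc := lF c x.
have : q c * h <= 0.
  rewrite /q; have [h0|h0] := leP 0 h.
    rewrite mulr_le0_ge0//.
    have xc : x <= c by case/orP: cI => /andP[] *; lra.
    by move: lc; rewrite (ger0_norm (_ : 0 <= c - x)) ?subr_ge0// ler_norml; lra.
  rewrite mulr_ge0_le0//; last exact: ltW.
  have xc : c <= x by case/orP: cI => /andP[] *; lra.
  by move: lc; rewrite (ler0_norm (_ : c - x <= 0)) ?subr_le0// ler_norml; lra.
rewrite /Q => + eq; move: eq.
by rewrite [x + h - x]addrC addKr; nra.
Qed.

Lemma antiderivative_ge_quadratic (R : realType) (F H : R -> R) : lip1 F ->
  (forall x, is_derive x (1 : R) H (F x)) ->
  forall x h, H x + F x * h - h ^+ 2 / 2 <= H (x + h).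
Proof.
move=> lF dH x h.
have lF' : lip1 (fun x => - F x) by move=> y z; rewrite -opprD normrN lF.
have dH' y : is_derive y (1 : R) (fun x => - H x) (- F y).
  by have := dH y; exact: is_deriveN.
have := antiderivative_le_quadratic lF' dH' x h; lra.
Qed.

(** Serves as a derivative test: at a minimum, a quadratic upper bound already forces the
    first-order coefficient to vanish. The value tried is the minimizer [- a / (2 * C)]. *)
Lemma affine_quadratic_ge0 (R : realFieldType) (a C : R) : 0 < C ->
  (forall h, 0 <= a * h + C * h ^+ 2) -> a = 0.
Proof.
move=> C0 /(_ (- a / (2 * C))).
have -> : a * (- a / (2 * C)) + C * (- a / (2 * C)) ^+ 2 = - (a ^+ 2 / (4 * C)).
  by field; rewrite gt_eqF.
rewrite oppr_ge0 pmulr_lle0 ?invr_gt0 ?mulr_gt0// => a2.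
by apply/eqP; rewrite -sqrf_eq0 eq_le a2 sqr_ge0.
Qed.

(** * The action and its quadratic estimates *)

Section action.
Context {R : realType} (F G HF HG : R -> R).
Hypotheses (lipF : lip1 F) (lipG : lip1 G).
Hypothesis dHF : forall x, is_derive x (1 : R) HF (F x).
Hypothesis dHG : forall x, is_derive x (1 : R) HG (G x).
Variable tau : R.
Hypothesis tau01 : 0 < tau <= 1.
Implicit Types w p s r t h : R.

(** The coefficient [w] of [r ^+ 2] stands for [2 / tau]; it is kept free because strong
    concavity in [r] requires [w > 2], which fails at [tau = 1] (right angle). *)
Definition action w p s r :=
  HF (p + r + s) + HG (p - r - s) - HF (p + r - s) - HG (p - r + s)
  - w * r ^+ 2 + 2 * tau * s ^+ 2.

(** With [action_s] and [action_r], these are the partial derivatives of [action]. *)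
Definition action_p p s r :=
  F (p + r + s) + G (p - r - s) - F (p + r - s) - G (p - r + s).

Definition action_s p s r :=
  F (p + r + s) - G (p - r - s) + F (p + r - s) - G (p - r + s) + 4 * tau * s.

Definition action_r w p s r :=
  F (p + r + s) - G (p - r - s) - F (p + r - s) + G (p - r + s) - 2 * w * r.

Let ubF := antiderivative_le_quadratic lipF dHF.
Let ubG := antiderivative_le_quadratic lipG dHG.
Let lbF := antiderivative_ge_quadratic lipF dHF.
Let lbG := antiderivative_ge_quadratic lipG dHG.

(** Each of the four antiderivatives contributes an error of at most [t ^+ 2 / 2]; their total
    [2 * t ^+ 2] is absorbed by [- w * t ^+ 2]. *)
Lemma action_concave w p s r t :
  action w p s (r + t) <=
  action w p s r + action_r w p s r * t - (w - 2) * t ^+ 2.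
Proof.
have := ubF (p + r + s) t; rewrite (_ : _ + t = p + (r + t) + s); last ring.
have := ubG (p - r - s) (- t).
rewrite (_ : _ + - t = p - (r + t) - s); last ring.
have := lbF (p + r - s) t; rewrite (_ : _ + t = p + (r + t) - s); last ring.
have := lbG (p - r + s) (- t).
rewrite (_ : _ + - t = p - (r + t) + s); last ring.
by rewrite /action /action_r => *; lra.
Qed.

Lemma action_le_p w p s r h :
  action w (p + h) s r <= action w p s r + action_p p s r * h + 2 * h ^+ 2.
Proof.
have := ubF (p + r + s) h; rewrite (_ : _ + h = p + h + r + s); last ring.
have := ubG (p - r - s) h; rewrite (_ : _ + h = p + h - r - s); last ring.
have := lbF (p + r - s) h; rewrite (_ : _ + h = p + h + r - s); last ring.
have := lbG (p - r + s) h; rewrite (_ : _ + h = p + h - r + s); last ring.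
by rewrite /action /action_p => *; lra.
Qed.

Lemma action_le_s w p s r h :
  action w p (s + h) r <=
  action w p s r + action_s p s r * h + (2 + 2 * tau) * h ^+ 2.
Proof.
have := ubF (p + r + s) h; rewrite (_ : _ + h = p + r + (s + h)); last ring.
have := ubG (p - r - s) (- h).
rewrite (_ : _ + - h = p - r - (s + h)); last ring.
have := lbF (p + r - s) (- h).
rewrite (_ : _ + - h = p + r - (s + h)); last ring.
have := lbG (p - r + s) h; rewrite (_ : _ + h = p - r + (s + h)); last ring.
by rewrite /action /action_s => *; lra.
Qed.

Lemma action_r_lip w p s r p' s' :
  `|action_r w p' s' r - action_r w p s r| <= 4 * (`|p' - p| + `|s' - s|).
Proof.
have H (X : R -> R) (e : R) : lip1 X -> (e == 1) || (e == -1) -> forall a,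
    `|X (p' + a + e * s') - X (p + a + e * s)| <= `|p' - p| + `|s' - s|.
  move=> lX e1 a; apply: le_trans (lX _ _) _.
  have -> : p' + a + e * s' - (p + a + e * s) = (p' - p) + e * (s' - s) by ring.
  apply: le_trans (ler_normD _ _) _; rewrite lerD2l normrM.
  by case/orP: e1 => /eqP->; rewrite ?normrN normr1 mul1r.
have e1 : (1 == 1 :> R) || (1 == -1 :> R) by rewrite eqxx.
have eN1 : (-1 == 1 :> R) || (-1 == -1 :> R) by rewrite eqxx orbT.
have := H _ _ lipF e1 r; have := H _ _ lipF eN1 r.
have := H _ _ lipG e1 (- r); have := H _ _ lipG eN1 (- r).
rewrite !mul1r !mulN1r /action_r !ler_norml => /andP[? ?] /andP[? ?] /andP[? ?] /andP[? ?].
by apply/andP; split; lra.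
Qed.

(** Apart from [- 2 * w * r], [action_r] is at most [4 * |s| <= 2 * w * |s|] in absolute value, so
    it changes sign between [- |s|] and [|s|]. *)
Lemma ex_action_r0 w p s : 2 <= w ->
  exists2 r, `|r| <= `|s| & action_r w p s r = 0.
Proof.
move=> w2.
have bnd r : `|action_r w p s r + 2 * w * r| <= 4 * `|s|.
  have := lipF (p + r + s) (p + r - s); have := lipG (p - r + s) (p - r - s).
  rewrite (_ : p - r + s - _ = 2 * s); last ring.
  rewrite (_ : p + r + s - _ = 2 * s); last ring.
  rewrite normrM ger0_norm// !ler_norml /action_r => /andP[? ?] /andP[? ?].
  by apply/andP; split; lra.
have s0 := normr_ge0 s.
have ws : 2 * `|s| <= w * `|s| by rewrite ler_wpM2r.
have [||| r] := @IVT R (fun r => action_r w p s r) (- `|s|) `|s| 0.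
- lra.
- apply: continuous_subspaceT => r.
  have cX (X g : R -> R) : lip1 X -> {for r, continuous g} ->
      {for r, continuous (X \o g)}.
    by move=> /lip1_continuous cX cg; apply: continuous_comp; [exact: cg|exact: cX].
  have cr : {for r, continuous (fun r : R => r)} by exact: cvg_id.
  have cc (a : R) : {for r, continuous (fun=> a)} by exact: cvg_cst.
  rewrite /action_r; apply: cvgB; last by apply: cvgM; [exact: cc|exact: cr].
  apply: cvgD; [apply: cvgB; [apply: cvgB|]|];
    apply: cX => //; repeat first [exact: cc|exact: cr|apply: cvgB|apply: cvgD].
- have := bnd (- `|s|); have := bnd `|s|.
  rewrite !ler_norml => /andP[? ?] /andP[? ?].
  rewrite ge_min le_max; apply/andP; split; apply/orP; [right|left]; lra.
- by rewrite in_itv/= -ler_norml => rs eq; exists r.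
Qed.

(** * Critical points by min-max *)

Variable B : R.
Hypotheses (bF : forall x, `|F x| <= B) (bG : forall x, `|G x| <= B).
Hypothesis FG01 : forall x, 0 <= F x - G x <= 1.
Hypothesis FGsupp : forall x, F x != G x -> 0 < x < 1.

(** At [r = 0] the mean value theorem turns the action into [2 * s * (F c - G c + tau * s)] with [c]
    between [p - s] and [p + s]. Negativity forces [s < 0] and [F c - G c > - tau * s > 0], which
    puts [c] in (0, 1) and bounds [s]. This confinement provides the compactness for the minimum
    over (p, s). *)
Lemma action_r0_lt0_bounded w p s : action w p s 0 < 0 ->
  - tau^-1 <= s < 0 /\ - tau^-1 <= p <= 1 + tau^-1.
Proof.
have [tau0 tau1] := andP tau01.
have dK x : is_derive x (1 : R) (HF - HG) (F x - G x).
  by have := dHF x; have := dHG x; move=> *; exact: is_deriveB.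
have [c cI] := antiderivative_MVT dK (p - s) (p + s).
rewrite /action !fctE expr0n/= mulr0 subr0 !addr0 !subr0 => eq lt0.
have {}lt0 : (F c - G c + tau * s) * s < 0 by nra.
have /andP[k0 k1] := FG01 c.
have s0 : s < 0 by rewrite ltNge; apply/negP => s0; nra.
have ks : 0 < F c - G c + tau * s by nra.
have /FGsupp/andP[c0 c1] : F c != G c by apply/eqP => e; nra.
have st : - tau^-1 <= s.
  by rewrite lerNl -(ler_pM2l tau0) mulfV ?gt_eqF//; lra.
by case/orP: cI => /andP[] *; split; apply/andP; split; lra.
Qed.

(** The constant does not depend on [r], so the estimate passes to the maximum over [r]. *)
Lemma action_lip w p s p' s' r S : `|s| <= S -> `|s'| <= S ->
  action w p s r <=
  action w p' s' r + (4 * B + 4 * S) * (`|p - p'| + `|s - s'|).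
Proof.
move=> sS s'S; have [tau0 tau1] := andP tau01.
have B0 : 0 <= B by apply: le_trans (bF 0).
set d := _ + `|s - s'|.
have H (X HX : R -> R) (a b b' : R) :
    (forall x, is_derive x (1 : R) HX (X x)) -> (forall x, `|X x| <= B) ->
    `|b - b'| <= d -> `|HX b - HX b'| <= B * d.
  by move=> dX bX bd; apply: le_trans (antiderivative_lip dX bX _ _) _; rewrite ler_wpM2l.
have dP : `|p - p' + (s - s')| <= d by exact: ler_normD.
have dN : `|p - p' - (s - s')| <= d by exact: ler_normB.
have HA : `|HF (p + r + s) - HF (p' + r + s')| <= B * d.
  by apply: (H F) => //; rewrite (_ : _ - _ = p - p' + (s - s')); last ring.
have HB : `|HG (p - r - s) - HG (p' - r - s')| <= B * d.
  by apply: (H G) => //; rewrite (_ : _ - _ = p - p' - (s - s')); last ring.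
have HC : `|HF (p + r - s) - HF (p' + r - s')| <= B * d.
  by apply: (H F) => //; rewrite (_ : _ - _ = p - p' - (s - s')); last ring.
have HD : `|HG (p - r + s) - HG (p' - r + s')| <= B * d.
  by apply: (H G) => //; rewrite (_ : _ - _ = p - p' + (s - s')); last ring.
have d0 : 0 <= d by rewrite addr_ge0.
have ds : `|s - s'| <= d by rewrite lerDr.
have : 2 * tau * (s ^+ 2 - s' ^+ 2) <= 4 * S * d.
  rewrite subr_sqr; apply: le_trans (ler_norm _) _.
  rewrite !normrM (ger0_norm (ler0n _ _)) (gtr0_norm tau0).
  have sS2 : `|s + s'| <= 2 * S by apply: le_trans (ler_normD _ _) _; lra.
  have : `|s - s'| * `|s + s'| <= d * (2 * S) by rewrite ler_pM.
  have : 0 <= `|s - s'| * `|s + s'| by rewrite mulr_ge0.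
  by nra.
move: HA HB HC HD; rewrite /action !ler_norml.
by do 4 move=> /andP[? ?]; lra.
Qed.

(** The minimum over (p, s) of [M = max_r action] need not be differentiated through [r]:
    concavity in [r] bounds [M] near the minimum by the action at the fixed maximizer [r]
    up to a quadratic error. *)
Lemma ex_critical w p0 s0 c : 2 < w -> 0 < c ->
  (forall r, action w p0 s0 r <= - c) ->
  exists p s r, [/\ action_p p s r = 0, action_s p s r = 0,
    action_r w p s r = 0, action w p s r <= - c &
    [/\ - tau^-1 <= p <= 1 + tau^-1, - tau^-1 <= s <= 0 & `|r| <= `|s|]].
Proof.
move=> w2 c0 bc; have [tau0 tau1] := andP tau01.
have S0 : 0 < tau^-1 by rewrite invr_gt0.
have /choice[rm rmP] : forall y : R * R, exists r,
    `|r| <= `|y.2| /\ action_r w y.1 y.2 r = 0.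
  by move=> y; have [r ? ?] := ex_action_r0 y.1 y.2 (ltW w2); exists r.
pose M y := action w y.1 y.2 (rm y).
(* By concavity the critical point [rm y] is a global maximizer in [r]. *)
have Mmax y r : action w y.1 y.2 r <= M y.
  have := action_concave w y.1 y.2 (rm y) (r - rm y).
  rewrite (rmP y).2 mul0r addr0 (_ : _ + _ = r); last ring.
  move=> /le_trans; apply; rewrite gerBl mulr_ge0 ?sqr_ge0//; lra.
pose A : set (R * R) := `[- tau^-1, 1 + tau^-1] `*` `[- tau^-1, 0].
have AP y : M y < 0 -> A y.
  move=> My0; have /action_r0_lt0_bounded[/andP[? ?] ?] : action w y.1 y.2 0 < 0.
    exact: le_lt_trans (Mmax y 0) _.
  by split => /=; rewrite in_itv//=; apply/andP; split => //; exact: ltW.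
have As y : A y -> `|y.2| <= tau^-1.
  by move=> [_]; rewrite /= in_itv/= ler_norml => /andP[? ?]; apply/andP; split; lra.
have M0 : M (p0, s0) <= - c by exact: bc.
have [||| [p s] Aps Mmin] := @compact_EVT_min _ _ M A.
- by exists (p0, s0); apply: AP; lra.
- by apply: compact_setX; exact: segment_compact.
- apply/subspace_continuousP => y Ay; apply/cvgrPdist_lt => e e0.
  pose C := 4 * B + 4 * tau^-1.
  have B0 : 0 <= B by apply: le_trans (bF 0).
  have C0 : 0 < C by rewrite /C; lra.
  have e'0 : 0 < e / (2 * C) by rewrite divr_gt0// mulr_gt0.
  near=> z; rewrite -[_ < _]/(`|M y - M z| < e).
  have Az : A z by near: z; exact: withinT.
  have z1 : `|y.1 - z.1| < e / (2 * C).
    near: z; apply: cvg_within.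
    have /cvgrPdist_lt : z.1 @[z --> y] --> y.1 by exact: cvg_fst.
    exact.
  have z2 : `|y.2 - z.2| < e / (2 * C).
    near: z; apply: cvg_within.
    have /cvgrPdist_lt : z.2 @[z --> y] --> y.2 by exact: cvg_snd.
    exact.
  (* Both points are compared at the maximizer [rm u] of the first one. *)
  have L u v : A u -> A v -> M u <= M v + C * (`|u.1 - v.1| + `|u.2 - v.2|).
    move=> /As Au /As Av; apply: le_trans (action_lip _ u.1 v.1 _ Au Av) _.
    by rewrite lerD2r; exact: Mmax.
  have lt : C * (`|y.1 - z.1| + `|y.2 - z.2|) < e.
    rewrite mulrC -ltr_pdivlMr// (_ : e / C = e / (2 * C) + e / (2 * C)) ?ltrD//.
    by field; rewrite gt_eqF.
  have := L _ _ Ay Az; have := L _ _ Az Ay.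
  rewrite [`|z.1 - _|]distrC [`|z.2 - _|]distrC ltr_norml => *.
  by apply/andP; split; lra.
have Mle : M (p, s) <= - c.
  have A0 : A (p0, s0) by apply: AP; lra.
  by apply: le_trans (Mmin (p0, s0) _) M0; rewrite inE.
(* The minimum over the box is global: outside the box [M] is nonnegative, while the minimum is at
   most [- c]. *)
have {}Mmin y : M (p, s) <= M y.
  have [/AP Ay|] := ltP (M y) 0; first by apply: Mmin; rewrite inE.
  by lra.
set r := rm (p, s).
pose k := w - 2; have k0 : 0 < k by rewrite /k; lra.
(* The hypothesis holds when [y] differs from [(p, s)] in a single coordinate, so [key] covers
   variations in [p] and in [s] at once. *)
have key y : `|y.1 - p| + `|y.2 - s| = `|y.1 - p + (y.2 - s)| ->
    M y <= action w y.1 y.2 r + 4 / k * (y.1 - p + (y.2 - s)) ^+ 2.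
  move=> e; pose t := rm y - r.
  have := action_concave w y.1 y.2 r t.
  rewrite -/k {1}/t (_ : r + _ = rm y) -/(M y); last ring.
  move=> /le_trans; apply; rewrite -addrA lerD2l.
  have := action_r_lip w p s r y.1 y.2.
  rewrite (rmP (p, s)).2 subr0 e => lr.
  set a := action_r _ _ _ _ in lr *.
  have at4 : a * t <= (4 * `|y.1 - p + (y.2 - s)|) * `|t|.
    by apply: le_trans (ler_norm _) _; rewrite normrM ler_wpM2r.
  rewrite -[(_ + (y.2 - s)) ^+ 2]real_normK ?num_real//.
  rewrite -[t ^+ 2]real_normK ?num_real//.
  set h := `|_ + _| in at4 *.
  (* Completing the square bounds [4 * h * |t| - k * |t| ^+ 2] by [4 / k * h ^+ 2]. *)
  have : 0 <= k^-1 * (k * `|t| - 2 * h) ^+ 2 by rewrite mulr_ge0 ?sqr_ge0 ?invr_ge0// ltW.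
  have -> : k^-1 * (k * `|t| - 2 * h) ^+ 2 =
    k * `|t| ^+ 2 - 4 * h * `|t| + 4 / k * h ^+ 2 by field; rewrite gt_eqF.
  by lra.
(* The 4 dominates both error constants, [2] in [p] and [2 + 2 * tau] in [s]. *)
have C0 : 0 < 4 + 4 / k by rewrite addr_gt0 ?divr_gt0.
exists p, s, r; split => //.
- apply: (affine_quadratic_ge0 C0) => h.
  have := key (p + h, s); rewrite /= subrr normr0 !addr0 => /(_ erefl).
  rewrite (_ : p + h - p = h); last ring.
  have := action_le_p w p s r h; have := Mmin (p + h, s).
  have : 0 <= h ^+ 2 by exact: sqr_ge0.
  by rewrite {1}/M /= -/r; lra.
- apply: (affine_quadratic_ge0 C0) => h.
  have := key (p, s + h); rewrite /= subrr normr0 !add0r => /(_ erefl).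
  rewrite (_ : s + h - s = h); last ring.
  have := action_le_s w p s r h; have := Mmin (p, s + h).
  have : 0 <= h ^+ 2 by exact: sqr_ge0.
  have : tau * h ^+ 2 <= h ^+ 2 by rewrite ler_piMl ?sqr_ge0.
  by rewrite {1}/M /= -/r; lra.
- exact: (rmP (p, s)).2.
- move: Aps; rewrite inE => -[]/=; rewrite !in_itv/= => ? ?.
  by split => //; exact: (rmP (p, s)).1.
Unshelve. all: by end_near. Qed.

(** Expansion about [2^-1], with [d] the gap [F - G] there and [tau <= 1], bounds the action by [2 *
    d * s + 4 * s ^+ 2 - (w - 2) * r ^+ 2]; the chosen [s = - (d / 4)] minimizes the part in [s]. *)
Lemma action_half_lt0 w r : 2 <= w ->
  action w 2^-1 (- ((F 2^-1 - G 2^-1) / 4)) r <= - ((F 2^-1 - G 2^-1) ^+ 2 / 4).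
Proof.
move=> w2; have [tau0 tau1] := andP tau01.
set d := F _ - _; set s := - (d / 4).
have := ubF 2^-1 (r + s); rewrite addrA.
have := ubG 2^-1 (- r - s); rewrite addrA.
have := lbF 2^-1 (r - s); rewrite addrA.
have := lbG 2^-1 (- r + s); rewrite addrA.
have : 0 <= (w - 2) * r ^+ 2 by rewrite mulr_ge0 ?sqr_ge0 ?subr_ge0.
have : tau * s ^+ 2 <= s ^+ 2 by rewrite ler_piMl ?sqr_ge0.
have Fd : F 2^-1 = d + G 2^-1 by rewrite /d; ring.
by rewrite /action Fd /s => *; lra.
Qed.

(** Critical points for [w > 2 / tau] at levels bounded away from [0] accumulate, as [w]
    decreases to [2 / tau], at a zero of the nonnegative function [N] below. *)
Lemma ex_action_critical : G 2^-1 < F 2^-1 ->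
  exists p s r, [/\ action_p p s r = 0, action_s p s r = 0,
    action_r (2 / tau) p s r = 0 & action (2 / tau) p s r < 0].
Proof.
move=> GF; have [tau0 tau1] := andP tau01.
set w := 2 / tau; set S := tau^-1.
have S0 : 0 < S by rewrite invr_gt0.
have w2 : 2 <= w by rewrite /w ler_pdivlMr//; lra.
(* This is half the depth given by [action_half_lt0]; the other half pays for the change of [w]. *)
pose c := (F 2^-1 - G 2^-1) ^+ 2 / 8.
have c0 : 0 < c by rewrite divr_gt0// exprn_gt0// subr_gt0.
pose X (y : R * R * R) := action w y.1.1 y.1.2 y.2 + c.
(* The summand [X y + |X y|] vanishes exactly when the action is at most [- c]. *)
pose N (y : R * R * R) := `|action_p y.1.1 y.1.2 y.2| +
  `|action_s y.1.1 y.1.2 y.2| + `|action_r w y.1.1 y.1.2 y.2| + (X y + `|X y|).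
have cN : continuous N.
  move=> y.
  have c1 : {for y, continuous (fun y : R * R * R => y.1.1)}.
    by apply: continuous_comp; exact: cvg_fst.
  have c2 : {for y, continuous (fun y : R * R * R => y.1.2)}.
    by apply: continuous_comp; [exact: cvg_fst|exact: cvg_snd].
  have c3 : {for y, continuous (fun y : R * R * R => y.2)} by exact: cvg_snd.
  have cc (a : R) : {for y, continuous (fun=> a)} by exact: cvg_cst.
  have cX (Y : R -> R) (g : R * R * R -> R) : continuous Y ->
      {for y, continuous g} -> {for y, continuous (fun y => Y (g y))}.
    by move=> cY cg; apply: continuous_comp; [exact: cg|exact: cY].
  have cH (Y HY : R -> R) : (forall x, is_derive x (1 : R) HY (Y x)) -> continuous HY.
    move=> dY x; apply: differentiable_continuous.
    by apply/derivable1_diffP; have [] := dY x.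
  have cA : {for y, continuous (fun y : R * R * R => y.1.1 + y.2 + y.1.2)}.
    by apply: cvgD; [apply: cvgD; [exact: c1|exact: c3]|exact: c2].
  have cC : {for y, continuous (fun y : R * R * R => y.1.1 - y.2 - y.1.2)}.
    by apply: cvgB; [apply: cvgB; [exact: c1|exact: c3]|exact: c2].
  have cB : {for y, continuous (fun y : R * R * R => y.1.1 + y.2 - y.1.2)}.
    by apply: cvgB; [apply: cvgD; [exact: c1|exact: c3]|exact: c2].
  have cD : {for y, continuous (fun y : R * R * R => y.1.1 - y.2 + y.1.2)}.
    by apply: cvgD; [apply: cvgB; [exact: c1|exact: c3]|exact: c2].
  have FA := cX _ _ (lip1_continuous lipF) cA.
  have FB := cX _ _ (lip1_continuous lipF) cB.
  have GC := cX _ _ (lip1_continuous lipG) cC.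
  have GD := cX _ _ (lip1_continuous lipG) cD.
  have HA := cX _ _ (cH _ _ dHF) cA; have HB := cX _ _ (cH _ _ dHF) cB.
  have HC := cX _ _ (cH _ _ dHG) cC; have HD := cX _ _ (cH _ _ dHG) cD.
  have cXy : {for y, continuous X}.
    apply: cvgD; last exact: cc.
    apply: cvgD; last by apply: cvgM; [exact: cc|apply: cvgM; exact: c2].
    apply: cvgB; last by apply: cvgM; [exact: cc|apply: cvgM; exact: c3].
    by apply: cvgB; [apply: cvgB; [apply: cvgD; [exact: HA|exact: HC]|exact: HB]|exact: HD].
  have cP : {for y, continuous (fun y => action_p y.1.1 y.1.2 y.2)}.
    by apply: cvgB; [apply: cvgB; [apply: cvgD; [exact: FA|exact: GC]|exact: FB]|exact: GD].
  have cS : {for y, continuous (fun y => action_s y.1.1 y.1.2 y.2)}.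
    apply: cvgD; last by apply: cvgM; [exact: cc|exact: c2].
    by apply: cvgB; [apply: cvgD; [apply: cvgB; [exact: FA|exact: GC]|exact: FB]|exact: GD].
  have cR : {for y, continuous (fun y => action_r w y.1.1 y.1.2 y.2)}.
    apply: cvgB; last by apply: cvgM; [exact: cc|exact: c3].
    by apply: cvgD; [apply: cvgB; [apply: cvgB; [exact: FA|exact: GC]|exact: FB]|exact: GD].
  apply: cvgD; last by apply: cvgD; [exact: cXy|apply: cvg_norm; exact: cXy].
  apply: cvgD; last by apply: cvg_norm; exact: cR.
  by apply: cvgD; apply: cvg_norm; [exact: cP|exact: cS].
pose A := `[- S, 1 + S] `*` `[- S, 0] `*` `[- S, S].
(* A critical point for [w + k] at level [- (2 * c)] is reused for [w]: the action rises by
   [k * r ^+ 2 <= c], and [action_r] becomes [2 * k * r]. *)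
have near0 k : 0 < k -> k * S ^+ 2 <= c -> exists2 y, A y & N y <= 2 * k * S.
  move=> k0 kc; have [||r|p [s [r [Ep Es Er E [pb sb rs]]]]] :=
    @ex_critical (w + k) 2^-1 (- ((F 2^-1 - G 2^-1) / 4)) (2 * c).
  - by lra.
  - by lra.
  - apply: le_trans (action_half_lt0 _ _) _; first by lra.
    by rewrite /c; lra.
  rewrite -/S in pb sb.
  have {}rs : `|r| <= S.
    by apply: le_trans rs _; rewrite ler_norml; case/andP: sb => *; apply/andP; split; lra.
  exists (p, s, r).
    by split; [split|] => /=; rewrite in_itv//= -ler_norml.
  have r2 : r ^+ 2 <= S ^+ 2 by rewrite -real_normK ?num_real// ler_sqr ?nnegrE// ltW.
  have X0 : X (p, s, r) <= 0.
    have : k * r ^+ 2 <= k * S ^+ 2 by rewrite ler_pM2l.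
    by move: E; rewrite /X /action /=; lra.
  rewrite /N/= Ep Es (ler0_norm X0) subrr addr0 normr0 !add0r.
  have -> : action_r w p s r = 2 * k * r by move: Er; rewrite /action_r; lra.
  by rewrite !normrM normr_nat (gtr0_norm k0) ler_wpM2l// mulr_ge0// ltW.
have k10 : 0 < c / S ^+ 2 by rewrite divr_gt0// exprn_gt0.
have [||| y Ay Nmin] := @compact_EVT_min _ _ N A.
- have [|y Ay _] := near0 _ k10; last by exists y.
  by rewrite divfK// gt_eqF// exprn_gt0.
- by do 2 ?apply: compact_setX; exact: segment_compact.
- by apply: continuous_subspaceT => z; exact: cN.
have Ny : N y <= 0.
  rewrite leNgt; apply/negP => Ny0.
  (* The second bound on [k] gives a point with [N z <= N y / 2], contradicting minimality. *)
  pose k := Num.min (c / S ^+ 2) (N y / (4 * S)).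
  have k0 : 0 < k by rewrite lt_min k10 divr_gt0// mulr_gt0.
  have kc : k * S ^+ 2 <= c by rewrite -ler_pdivlMr ?exprn_gt0// ge_min lexx.
  have kN : k * (4 * S) <= N y by rewrite -ler_pdivlMr ?mulr_gt0// ge_min lexx orbT.
  have [z Az Nz] := near0 k k0 kc.
  by have := Nmin z; rewrite inE => /(_ Az); lra.
have XX : 0 <= X y + `|X y| by have := ler_norm (- X y); rewrite normrN; lra.
have n1 := normr_ge0 (action_p y.1.1 y.1.2 y.2).
have n2 := normr_ge0 (action_s y.1.1 y.1.2 y.2).
have n3 := normr_ge0 (action_r w y.1.1 y.1.2 y.2).
exists y.1.1, y.1.2, y.2; split; last first.
  have XE : X y = action w y.1.1 y.1.2 y.2 + c by [].
  by have := normr_ge0 (X y); move: Ny; rewrite /N; lra.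
all: by apply/normr0_eq0/eqP; rewrite eq_le; apply/andP; split => //; move: Ny; rewrite /N; lra.
Qed.

(** Linear combinations of the critical equations. With A, B, C, D over [p + r + s], [p + r - s],
    [p - r - s], [p - r + s], they say that AB and DC equal [(- 2 * s, - 2 * r / tau)] and that AD
    and BC are this vector turned clockwise by a right angle and scaled by [tau]. *)
Lemma ex_rectangle_equations : G 2^-1 < F 2^-1 ->
  exists p s r, [/\ s < 0, `|r| <= - (tau * s) &
    [/\ F (p + r + s) - F (p + r - s) = 2 * r / tau,
      G (p - r + s) - G (p - r - s) = 2 * r / tau,
      F (p + r + s) - G (p - r + s) = - (2 * tau * s) &
      F (p + r - s) - G (p - r - s) = - (2 * tau * s)]].
Proof.
move=> /ex_action_critical[p [s [r [Ep Es Er E]]]]; have [tau0 tau1] := andP tau01.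
have s0 : s < 0.
  have [|/andP[]//] := @action_r0_lt0_bounded (2 / tau) p s.
  (* As [r] maximizes the action, the value at [r = 0] is negative as well. *)
  apply: le_lt_trans E; rewrite -[X in action _ _ _ X <= _](subrr r).
  have := action_concave (2 / tau) p s r (- r).
  rewrite Er mul0r addr0 => /le_trans; apply; rewrite gerBl mulr_ge0 ?sqr_ge0//.
  by rewrite subr_ge0 ler_pdivlMr//; lra.
have FF : F (p + r + s) - F (p + r - s) = 2 * r / tau.
  by move: Ep Er; rewrite /action_p /action_r => *; lra.
exists p, s, r; split => //; last first.
  by move: Ep Es Er; rewrite /action_p /action_s /action_r => *; split=> //; lra.
(* The side AB is a chord of [F], so its slope is at most 1 in absolute value. *)
have := lipF (p + r + s) (p + r - s); rewrite FF.
rewrite (_ : p + r + s - _ = 2 * s); last ring.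
rewrite !normrM normr_nat normfV (gtr0_norm tau0) (ltr0_norm s0).
by rewrite ler_pdivrMr//; lra.
Qed.

End action.

(** * Confinement to [0, 1] and extension by constants *)

(** If [x < 0], then [F x = F 0 = G 0], and [y > 0] since otherwise the two values agree. Then
    [F x - G y = G 0 - G y <= y < y - x], against the steepness hypothesis. The other three cases
    are symmetric. *)
Lemma lip1_pair_in01 (R : realType) (F G : R -> R) (x y : R) :
  lip1 F -> lip1 G ->
  (forall t, t <= 0 -> F t = F 0) -> (forall t, 1 <= t -> F t = F 1) ->
  (forall t, t <= 0 -> G t = F 0) -> (forall t, 1 <= t -> G t = F 1) ->
  `|x - y| <= F x - G y -> G y < F x ->
  (0 <= x <= 1) && (0 <= y <= 1).
Proof.
move=> lF lG F0 F1 G0 G1; rewrite ler_norml => /andP[h1 h2] GF.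
have bG t : `|G y - G t| <= `|y - t| by exact: lG.
have bF t : `|F x - F t| <= `|x - t| by exact: lF.
apply/andP; split; apply/andP; split; rewrite leNgt; apply/negP => lt.
- have Fx := F0 _ (ltW lt).
  have y0 : 0 < y by rewrite ltNge; apply/negP => /G0 Gy; lra.
  by have := bG 0; rewrite (G0 0)// subr0 (gtr0_norm y0) ler_norml => /andP[]; lra.
- have Fx := F1 _ (ltW lt).
  have y1 : y - 1 < 0.
    by rewrite subr_lt0 ltNge; apply/negP => /G1 Gy; lra.
  by have := bG 1; rewrite (G1 1)// (ltr0_norm y1) ler_norml => /andP[]; lra.
- have Gy := G0 _ (ltW lt).
  have x0 : 0 < x by rewrite ltNge; apply/negP => /F0 Fx; lra.
  by have := bF 0; rewrite subr0 (gtr0_norm x0) ler_norml => /andP[]; lra.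
- have Gy := G1 _ (ltW lt).
  have x1 : x - 1 < 0.
    by rewrite subr_lt0 ltNge; apply/negP => /F1 Fx; lra.
  by have := bF 1; rewrite (ltr0_norm x1) ler_norml => /andP[]; lra.
Qed.

Definition clamp01 (R : realType) (x : R) : R := Num.max 0 (Num.min 1 x).

Lemma clamp01_id (R : realType) (x : R) : 0 <= x <= 1 -> clamp01 x = x.
Proof. by move=> /andP[x0 x1]; rewrite /clamp01 min_r// max_r. Qed.

Lemma clamp01_le0 (R : realType) (x : R) : x <= 0 -> clamp01 x = 0.
Proof.
by move=> x0; rewrite /clamp01 min_r ?max_l// (le_trans x0).
Qed.

Lemma clamp01_ge1 (R : realType) (x : R) : 1 <= x -> clamp01 x = 1.
Proof. by move=> x1; rewrite /clamp01 min_l// max_r. Qed.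

Lemma clamp01_itv (R : realType) (x : R) : 0 <= clamp01 x <= 1.
Proof. by rewrite /clamp01 le_max lexx/= ge_max ler01 ge_min lexx. Qed.

Lemma lip1_clamp01 (R : realType) : lip1 (@clamp01 R).
Proof.
have cl (x : R) : [\/ x <= 0 /\ clamp01 x = 0, 0 <= x <= 1 /\ clamp01 x = x |
    1 <= x /\ clamp01 x = 1].
  have [x0|x0] := leP x 0; first by constructor 1; rewrite clamp01_le0.
  have [x1|x1] := leP 1 x; first by constructor 3; rewrite clamp01_ge1.
  by constructor 2; rewrite clamp01_id ?ltW.
have le (x y : R) : x <= y -> `|clamp01 x - clamp01 y| <= y - x.
  move=> xy; rewrite ler_norml.
  case: (cl x) => -[x01 ->]; case: (cl y) => -[y01 ->]; lra.
move=> x y; have [xy|/ltW yx] := leP x y.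
  by rewrite (ler0_norm (_ : x - y <= 0)) ?subr_le0// opprB le.
by rewrite distrC (ger0_norm (_ : 0 <= x - y)) ?subr_ge0// le.
Qed.

Lemma lip1_comp_clamp01 (R : realType) (f : R -> R) :
  1.-lipschitz_(`[0, 1]) f -> lip1 (f \o @clamp01 R).
Proof.
move=> lf x y /=; apply: le_trans (lip1_clamp01 x y).
have := lf (clamp01 x, clamp01 y); rewrite /= mul1r; apply.
by split; rewrite /= in_itv/= clamp01_itv.
Qed.

(** * Aspect ratio and angle of the diagonals *)

Lemma sin_cos_acute (R : realType) (theta : R) :
  0 < theta <= pi / 2 -> 0 < sin theta /\ 0 <= cos theta.
Proof.
move=> /andP[theta0 theta_pi]; split.
  rewrite sin_gt0_pi// theta0 (le_lt_trans theta_pi)//.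
  by rewrite ltr_pdivrMr// ltr_pMr ?pi_gt0// ltr1n.
rewrite cos_ge0_pihalf// theta_pi andbT (le_trans _ (ltW theta0))//.
by rewrite oppr_le0 divr_ge0// pi_ge0.
Qed.

(** The factor is tau = tan (theta / 2). The diagonals [u + v] and [v - u] have equal length, and
    their normalized dot product is [- (1 - tau ^+ 2) / (1 + tau ^+ 2) = - cos theta]. *)
Lemma theta_rectangle_quarter_turn (R : realType) (theta : R) (A u : R * R)
    (v := (sin theta / (1 + cos theta) * u.2,
           - (sin theta / (1 + cos theta) * u.1))) :
  0 < theta <= pi / 2 -> u != 0 ->
  theta_rectangle theta A (A + u) (A + u + v) (A + v).
Proof.
move=> htheta u0; have [s0 c0] := sin_cos_acute htheta.
have c1 : 0 < 1 + cos theta by lra.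
have tau0 : 0 < sin theta / (1 + cos theta) by rewrite divr_gt0.
have tau2 : (sin theta / (1 + cos theta)) ^+ 2 * (1 + cos theta) = 1 - cos theta.
  rewrite expr_div_n sin2cos2; field; lra.
rewrite /v; move: (sin theta / _) tau0 tau2 => tau tau0 tau2 {v}.
pose n := u.1 ^+ 2 + u.2 ^+ 2.
have n0 : 0 < n.
  rewrite lt_neqAle addr_ge0 ?sqr_ge0// andbT eq_sym paddr_eq0 ?sqr_ge0// !sqrf_eq0.
  by apply: contraNN u0; case: (u) => x y /= /andP[/eqP-> /eqP->].
set v := (_, _).
have v0 : v != 0.
  apply: contraNN u0; case: (u) @v => x y /=.
  by rewrite !xpair_eqE oppr_eq0 !mulf_eq0 gt_eqF//= andbC.
split.
  have ADD (z : R * R) : A + z - A = z by rewrite addrAC subrr add0r.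
  split; first by rewrite eq_sym -subr_eq0 ADD.
  - by rewrite eq_sym -subr_eq0 ADD.
  - by rewrite ADD [A + v]addrC opprD addrA addrK ADD.
  - by rewrite !ADD /dot /=; ring.
rewrite /line_angle -(addrA A u v) (addrC A (u + v)) addrK.
rewrite (addrC A v) opprD addrA addrK.
have nd : dot (v - u) (v - u) = (1 + tau ^+ 2) * n by rewrite /dot /n /=; ring.
have ns : dot (u + v) (u + v) = (1 + tau ^+ 2) * n by rewrite /dot /n /=; ring.
have nsd : dot (u + v) (v - u) = - ((1 - tau ^+ 2) * n) by rewrite /dot /n /=; ring.
have tau1 : 0 < 1 + tau ^+ 2 by rewrite ltr_pwDl ?sqr_ge0.
have tau2E : tau ^+ 2 = (1 - cos theta) / (1 + cos theta).
  by rewrite -tau2 mulfK// gt_eqF.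
have tau2le : 0 <= 1 - tau ^+ 2.
  by rewrite tau2E subr_ge0 ler_pdivrMr//; lra.
rewrite /enorm nd ns nsd normrN ger0_norm ?mulr_ge0 ?(ltW n0)//.
rewrite -expr2 sqr_sqrtr; last by rewrite mulr_ge0 ?(ltW n0) ?(ltW tau1).
rewrite (_ : _ / _ = cos theta); last first.
  rewrite tau2E; field; repeat (apply/andP; split); rewrite gt_eqF//; lra.
have /andP[theta0 theta_pi] := htheta.
rewrite cosK// in_itv/= (ltW theta0)/= (le_trans theta_pi)//.
by rewrite ler_pdivrMr// ler_peMr ?pi_ge0// ler1n.
Qed.

(** * Extension to the line and the inscribed rectangle *)

Theorem corollaryC (R : realType) (f g : R -> R)
    (fg0 : f 0 = g 0) (fg1 : f 1 = g 1)
    (gf : forall t : R, 0 < t < 1 -> g t < f t)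
    (lipf : 1.-lipschitz_(`[0, 1]) f)
    (lipg : 1.-lipschitz_(`[0, 1]) g)
    (theta : R) (htheta : 0 < theta <= pi / 2) :
  inscribes (gamma_curve f g) (theta_rectangle theta).
Proof.
have [s0 c0] := sin_cos_acute htheta.
pose tau := sin theta / (1 + cos theta).
have tau01 : 0 < tau <= 1.
  rewrite divr_gt0 ?ltr_wpDr//=.
  have c1 : 0 < 1 + cos theta by lra.
  by have := sin_le1 theta; rewrite ler_pdivrMr// mul1r; lra.
pose F := f \o @clamp01 R; pose G := g \o @clamp01 R.
have lF : lip1 F by exact: lip1_comp_clamp01.
have lG : lip1 G by exact: lip1_comp_clamp01.
have F0 t : t <= 0 -> F t = f 0 by move=> t0; rewrite /F/= clamp01_le0.
have F1 t : 1 <= t -> F t = f 1 by move=> t1; rewrite /F/= clamp01_ge1.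
have G0 t : t <= 0 -> G t = f 0 by move=> t0; rewrite /G/= clamp01_le0.
have G1 t : 1 <= t -> G t = f 1 by move=> t1; rewrite /G/= clamp01_ge1.
have FG t : F t != G t -> 0 < t < 1.
  move=> ne; have [t0|t0] := leP t 0; first by rewrite F0// G0// eqxx in ne.
  by have [t1|//] := leP 1 t; rewrite F1// G1// eqxx in ne.
have near0 (h : R -> R) t : 1.-lipschitz_(`[0, 1]) h -> `|h (clamp01 t) - h 0| <= 1.
  move=> lh; have /andP[t0 t1] := clamp01_itv t.
  have := lh (clamp01 t, 0); rewrite /= mul1r subr0 (ger0_norm t0) => lh0.
  by apply: le_trans (lh0 _) t1; split; rewrite /= in_itv/= ?clamp01_itv ?lexx ?ler01.
have Fb t : `|F t - f 0| <= 1 by exact: near0.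
have Gb t : `|G t - f 0| <= 1 by rewrite fg0; exact: near0.
have FG01 t : 0 <= F t - G t <= 1.
  have [->|/FG t01] := eqVneq (F t) (G t); first by rewrite subrr lexx ler01.
  have /andP[t0 t1] := t01.
  (* Comparison with the two endpoints gives [F t - G t <= 2 * t] and [F t - G t <= 2 * (1 - t)],
     whose average is 1. *)
  have := lF t 0; rewrite (F0 0)// subr0 (gtr0_norm t0) ler_norml => /andP[? ?].
  have := lF t 1; rewrite (F1 1)// (ltr0_norm (_ : t - 1 < 0)) ?subr_lt0// ler_norml => /andP[? ?].
  have := lG t 0; rewrite (G0 0)// subr0 (gtr0_norm t0) ler_norml => /andP[? ?].
  have := lG t 1; rewrite (G1 1)// (ltr0_norm (_ : t - 1 < 0)) ?subr_lt0// ler_norml => /andP[? ?].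
  have : G t < F t by rewrite /F /G/= clamp01_id ?gf// !ltW.
  by move=> ?; apply/andP; split; lra.
have [HF dHF] := antiderivative_of_continuous (lip1_continuous lF) F0.
have [HG dHG] := antiderivative_of_continuous (lip1_continuous lG) G0.
have bnd (X : R -> R) : (forall t, `|X t - f 0| <= 1) -> forall t, `|X t| <= 1 + `|f 0|.
  by move=> bX t; rewrite -[X t](subrK (f 0)) (le_trans (ler_normD _ _))// lerD2r.
have [|p [s [r [sn rs [EF EG EAD EBC]]]]] :=
    ex_rectangle_equations lF lG dHF dHG tau01 (bnd _ Fb) (bnd _ Gb) FG01 FG.
  by rewrite /F /G/= clamp01_id ?gf//; apply/andP; split; lra.
have /andP[tau0 tau1] := tau01.
have ts0 : 0 < - (tau * s) by rewrite -mulrN mulr_gt0// oppr_gt0.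
have F00 t : t <= 0 -> F t = F 0 by move=> /F0->; rewrite F0.
have F11 t : 1 <= t -> F t = F 1 by move=> /F1->; rewrite F1.
have G00 t : t <= 0 -> G t = F 0 by move=> /G0->; rewrite F0.
have G11 t : 1 <= t -> G t = F 1 by move=> /G1->; rewrite F1.
have r2 : `|2 * r| <= - (2 * tau * s) by rewrite normrM normr_nat; lra.
(* The sides AD and BC have width [|2 * r|], at most their height [- (2 * tau * s)], as the
   confinement lemma requires. *)
have /andP[A01 D01] : (0 <= p + r + s <= 1) && (0 <= p - r + s <= 1).
  apply: (lip1_pair_in01 lF lG) => //; last by lra.
  by rewrite EAD (_ : _ - _ = 2 * r); last ring.
have /andP[B01 C01] : (0 <= p + r - s <= 1) && (0 <= p - r - s <= 1).
  apply: (lip1_pair_in01 lF lG) => //; last by lra.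
  by rewrite EBC (_ : _ - _ = 2 * r); last ring.
have onF x : 0 <= x <= 1 -> gamma_curve f g (x, F x).
  by move=> x01; left; exists x; [rewrite /= in_itv|rewrite /F/= clamp01_id].
have onG x : 0 <= x <= 1 -> gamma_curve f g (x, G x).
  by move=> x01; right; exists x; [rewrite /= in_itv|rewrite /G/= clamp01_id].
exists (p + r + s, F (p + r + s)), (p + r - s, F (p + r - s)),
  (p - r - s, G (p - r - s)), (p - r + s, G (p - r + s)).
split; first by split; [exact: onF|exact: onF|exact: onG|exact: onG].
pose A := (p + r + s, F (p + r + s)); pose u := (- (2 * s), - (2 * r / tau)).
pose v := (tau * u.2, - (tau * u.1)).
have u0 : u != 0 by rewrite xpair_eqE oppr_eq0 mulf_eq0 pnatr_eq0/= lt_eqF.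
have -> : (p + r - s, F (p + r - s)) = A + u by congr pair => /=; lra.
have -> : (p - r + s, G (p - r + s)) = A + v.
  by congr pair => /=; [field; rewrite gt_eqF|lra].
have -> : (p - r - s, G (p - r - s)) = A + u + v.
  by congr pair => /=; [field; rewrite gt_eqF|lra].
exact: theta_rectangle_quarter_turn.
Qed.
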